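(* Let $G$ be an abstract group acting by isometries on metric spaces $X$ and $Y$ in such a way that every $G$-orbit in each space is closed. Let $f\colon X\to Y$ be a $G$-equivariant map with optimal lower and upper Lipschitz bounds $\alpha$ and $\beta$, respectively. Then the induced map $f_{/G}\colon X/G\to Y/G$, $G\cdot x\mapsto G\cdot f(x)$, has (optimal) lower Lipschitz bound at least $\alpha$ and (optimal) upper Lipschitz bound at most $\beta$. In particular, $\kappa(f_{/G})\leq\kappa(f)$.
   Context: For a map $f\colon X\to Y$ of metric spaces, the optimal lower and upper Lipschitz bounds $\alpha,\beta\in[0,\infty]$ are the largest and smallest constants (respectively) with $\alpha\, d_X(x,x')\le d_Y(f(x),f(x'))\le\beta\, d_X(x,x')$ for all $x,x'\in X$; the distortion of $f$ is $\kappa(f):=\beta/\alpha$, with $\kappa(f)=\infty$ if $\alpha=0$ or $\beta=\infty$. (On a one-point domain $\alpha=\infty$, $\beta=0$, and $\kappa=0$.) If a group $G$ acts by isometries on a metric space $X$ with closed orbits, the orbit space $X/G$ carries the quotient metric $d_{X/G}([x],[y])=\inf_{p\in[x],\,q\in[y]}d_X(p,q)$, where $[x]=G\cdot x$. *)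

(* Defs.v *)
From HB Require Import structures.
From mathcomp Require Import all_boot all_order all_algebra.
From mathcomp Require Import all_classical all_reals all_analysis.

Set Implicit Arguments.
Unset Strict Implicit.
Unset Printing Implicit Defensive.

Import Order.TTheory GRing.Theory Num.Theory.
Import numFieldNormedType.Exports.

Local Open Scope classical_set_scope.
Local Open Scope ring_scope.
Local Open Scope quotient_scope.

Section LipschitzBounds.
Context {R : realType} {X Y : metricType R} (f : X -> Y).
Local Open Scope ereal_scope.

(* In \bar R one has +oo * 0 = 0, so +oo is a lower bound exactly when X has at
   most one point, and +oo is always an upper bound. *)
Definition is_lip_lower (a : \bar R) : Prop :=
  0 <= a /\ forall x x' : X, a * (mdist x x')%:E <= (mdist (f x) (f x'))%:E.

Definition is_lip_upper (b : \bar R) : Prop :=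
  0 <= b /\ forall x x' : X, (mdist (f x) (f x'))%:E <= b * (mdist x x')%:E.

(* The supremum and the infimum below are attained: see [lip_lowerP] and
   [lip_upperP]. *)
Definition lip_lower : \bar R := ereal_sup is_lip_lower.

Definition lip_upper : \bar R := ereal_inf is_lip_upper.

(* In \bar R one has (+oo)^-1 = 0, which gives distortion 0 when X has at most
   one point. *)
Definition distortion : \bar R :=
  if (lip_lower == 0) || (lip_upper == +oo) then +oo
  else lip_upper / lip_lower.

Lemma lip_lowerP :
  is_lip_lower lip_lower /\ forall a, is_lip_lower a -> a <= lip_lower.
Proof.
have ub a : is_lip_lower a -> a <= lip_lower by exact: ereal_sup_ubound.
have l0 : is_lip_lower 0.
  by split=> // x x'; rewrite mul0e lee_fin mdist_ge0.
split=> //; split; first exact: ub.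
move=> x x'; have [->|xx'] := eqVneq x x'.
  by rewrite !mdistxx mule0.
have d0 : (0 < mdist x x')%R by rewrite mdist_gt0.
rewrite -lee_pdivlMr//.
by apply: ge_ereal_sup => a [_ /(_ x x')]; rewrite lee_pdivlMr.
Qed.

Lemma lip_upperP :
  is_lip_upper lip_upper /\ forall b, is_lip_upper b -> lip_upper <= b.
Proof.
have lb b : is_lip_upper b -> lip_upper <= b by exact: ereal_inf_lbound.
split=> //; split; first by apply: le_ereal_inf_tmp => b [].
move=> x x'; have [->|xx'] := eqVneq x x'.
  by rewrite !mdistxx mule0.
have d0 : (0 < mdist x x')%R by rewrite mdist_gt0.
rewrite -lee_pdivrMr//.
by apply: le_ereal_inf_tmp => b [_ /(_ x x')]; rewrite lee_pdivrMr.
Qed.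

Lemma distortion_le1 : (forall x x' : X, x = x') -> distortion = 0.
Proof.
move=> X1; rewrite /distortion.
have -> : lip_lower = +oo.
  apply/eqP; rewrite -leye_eq; apply lip_lowerP; split=> // x x'.
  by rewrite (X1 x x') !mdistxx mule0.
have -> : lip_upper = 0.
  apply/eqP; rewrite eq_le; apply/andP; split; last by case: lip_upperP => -[].
  apply lip_upperP; split=> // x x'.
  by rewrite (X1 x x') !mdistxx mule0.
by rewrite /= mul0e.
Qed.

End LipschitzBounds.

Record isometric_action (R : realType) (G : groupType) (X : metricType R) := {
  act :> G -> X -> X;
  act1 : forall x, act 1%g x = x;
  actM : forall g h x, act (g * h)%g x = act g (act h x);
  act_isometry : forall g x y, mdist (act g x) (act g y) = mdist x y
}.

Section Orbits.
Context {R : realType} {G : groupType} {X : metricType R}.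
Variable a : isometric_action G X.

Definition orbit (x : X) : set X := range (a^~ x).

Definition orbits_closed : Prop := forall x, closed (orbit x).

Definition same_orbit : rel X := fun x y => `[< orbit x y >].

Lemma actK g x : a g^-1%g (a g x) = x.
Proof. by rewrite -actM mulVg act1. Qed.

Lemma same_orbit_refl : reflexive same_orbit.
Proof. by move=> x; apply/asboolP; exists 1%g => //; rewrite act1. Qed.

Lemma same_orbit_sym : symmetric same_orbit.
Proof.
suff S x y : same_orbit x y -> same_orbit y x by move=> x y; apply/idP/idP => /S.
by move=> /asboolP[g _ <-]; apply/asboolP; exists g^-1%g => //; rewrite actK.
Qed.

Lemma same_orbit_trans : transitive same_orbit.
Proof.
move=> y x z /asboolP[g _ <-] /asboolP[h _ <-]; apply/asboolP.
by exists (h * g)%g => //; rewrite actM.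
Qed.

Canonical same_orbit_equiv :=
  EquivRel same_orbit same_orbit_refl same_orbit_sym same_orbit_trans.

(* The carrier does not depend on the closedness of the orbits; the argument is
   there because the metric structure on X/G requires it. *)
Definition orbit_space (_ : orbits_closed) : Type := {eq_quot same_orbit}.

Variable cl : orbits_closed.

HB.instance Definition _ := Choice.copy (orbit_space cl) {eq_quot same_orbit}.
HB.instance Definition _ := Quotient.copy (orbit_space cl) {eq_quot same_orbit}.

Definition orbit_class (x : X) : orbit_space cl := \pi_(orbit_space cl) x.

Lemma orbit_classP x y : orbit_class x = orbit_class y <-> orbit x y.
Proof.
split => [/eqmodP/asboolP//|xy].
by apply/eqmodP/asboolP.
Qed.

Lemma orbit_class_surj u : exists x, orbit_class x = u.
Proof. by exists (repr u); exact: reprK. Qed.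

(* By [orbit_classP], the points of the class u form an orbit. *)
Definition orbit_dist (u v : orbit_space cl) : R :=
  inf [set mdist p.1 p.2 | p in
        [set p : X * X | orbit_class p.1 = u /\ orbit_class p.2 = v]].

Let D_lb u v x y : orbit_class x = u -> orbit_class y = v ->
  orbit_dist u v <= mdist x y.
Proof.
move=> xu yv; apply: ge_inf; last by exists (x, y).
by exists 0 => _ [p _ <-]; exact: mdist_ge0.
Qed.

Let D_ne u v : [set mdist p.1 p.2 | p in
  [set p : X * X | orbit_class p.1 = u /\ orbit_class p.2 = v]] !=set0.
Proof.
have [x xu] := orbit_class_surj u; have [y yv] := orbit_class_surj v.
by exists (mdist x y), (x, y).
Qed.

Let D_ge0 u v : 0 <= orbit_dist u v.
Proof.
by apply: lb_le_inf; [exact: D_ne|move=> _ [p _ <-]; exact: mdist_ge0].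
Qed.

Let D_adh u v e : 0 < e -> exists p q,
  [/\ orbit_class p = u, orbit_class q = v & mdist p q < orbit_dist u v + e].
Proof.
move=> e0; have hi : has_inf [set mdist p.1 p.2 | p in
  [set p : X * X | orbit_class p.1 = u /\ orbit_class p.2 = v]].
  by split; [exact: D_ne|exists 0 => _ [p _ <-]; exact: mdist_ge0].
by have [_ [[p q] /= [pu qv] <-] lt] := inf_adherent e0 hi; exists p, q.
Qed.

Lemma orbit_distxx u : orbit_dist u u = 0.
Proof.
apply/eqP; rewrite eq_le D_ge0 andbT.
by have [x xu] := orbit_class_surj u; rewrite -(mdistxx x); exact: D_lb.
Qed.

Lemma orbit_dist_positivity u v : orbit_dist u v = 0 -> u = v.
Proof.
have [x xu] := orbit_class_surj u; have [y yv] := orbit_class_surj v.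
move=> uv0; rewrite -xu -yv; apply/orbit_classP.
apply: cl => B /nbhs_ballP[e /= e0 eB].
have [p [q [pu qv]]] := D_adh u v e0; rewrite uv0 add0r => pqe.
have /orbit_classP[g _ gp] : orbit_class x = orbit_class p by rewrite pu.
have /orbit_classP[h _ hq] : orbit_class q = orbit_class y by rewrite yv.
exists (a h p); split; first by exists (h * g)%g => //; rewrite actM gp.
by apply: eB; rewrite ballEmdist/= -hq act_isometry metric_sym.
Qed.

Lemma orbit_dist_sym u v : orbit_dist u v = orbit_dist v u.
Proof.
congr inf; rewrite eqEsubset; split=> _ [[p q] /= [pu qv] <-];
by exists (q, p) => //=; rewrite metric_sym.
Qed.

Lemma orbit_dist_triangle v u w :
  orbit_dist u w <= orbit_dist u v + orbit_dist v w.
Proof.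
apply/ler_addgt0Pl => e e0; have e20 : 0 < e / 2 by rewrite divr_gt0.
have [p [q [pu qv pq]]] := D_adh u v e20.
have [q' [r [qv' rw qr]]] := D_adh v w e20.
have /orbit_classP[g _ gq] : orbit_class q = orbit_class q' by rewrite qv.
have gpu : orbit_class (a g p) = u.
  by rewrite -pu; apply/esym/orbit_classP; exists g.
rewrite (le_trans (D_lb gpu rw))// (le_trans (metric_triangle _ q' _))//.
rewrite -{1}gq act_isometry (le_trans (ltW (ltrD pq qr)))//.
by rewrite addrACA -splitr addrC.
Qed.

HB.instance Definition _ := @isMetric.Build R (orbit_space cl) orbit_dist
  orbit_distxx orbit_dist_positivity orbit_dist_sym orbit_dist_triangle.

Lemma mdist_orbit_space (u v : orbit_space cl) : mdist u v = orbit_dist u v.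
Proof. by []. Qed.

End Orbits.

Section InducedMap.
Context {R : realType} {G : groupType} {X Y : metricType R}.
Variables (aX : isometric_action G X) (aY : isometric_action G Y).

Definition equivariant (f : X -> Y) : Prop :=
  forall g x, f (aX g x) = aY g (f x).

Variables (cX : orbits_closed aX) (cY : orbits_closed aY).

(* The choice of a representative is immaterial for an equivariant map: see
   [induced_mapE]. *)
Definition induced_map (f : X -> Y) (u : orbit_space cX) : orbit_space cY :=
  orbit_class cY (f (repr u)).

Lemma induced_mapE (f : X -> Y) : equivariant f ->
  forall x, induced_map f (orbit_class cX x) = orbit_class cY (f x).
Proof.
move=> fE x; rewrite /induced_map; apply/orbit_classP.
have : orbit_class cX (repr (orbit_class cX x)) = orbit_class cX x.
  exact: reprK.
by move=> /orbit_classP[g _ gx]; exists g => //; rewrite -fE gx.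
Qed.

End InducedMap.

Arguments induced_map {R G X Y aX aY} cX cY f u.

(* Main.v *)
(** Since [f] is equivariant, the points of the orbit of [f x] are the images of
    the points of the orbit of [x]; hence distances in [X/G] and in [Y/G] are
    infima of [mdist p q] and of [mdist (f p) (f q)] over the same pairs
    [(p, q)], and pointwise Lipschitz bounds pass to these infima. *)
Require Import Defs.
From mathcomp Require Import all_boot all_order all_algebra.
From mathcomp Require Import all_classical all_reals all_analysis.
Import Order.TTheory.
Local Open Scope classical_set_scope.
Local Open Scope ereal_scope.

(** Nonemptiness excludes [z = +oo], and also the default value [inf set0 = 0]. *)
Lemma le_EFin_inf (R : realType) (A : set R) (z : \bar R) : A !=set0 ->
  (forall r, A r -> z <= r%:E) -> z <= (inf A)%:E.
Proof.
move=> A0 zA; case: z zA => [r| |] zA; last exact: leNye.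
- by rewrite lee_fin; apply: lb_le_inf => // s /zA; rewrite lee_fin.
- by case: A0 => r /zA; rewrite leye_eq.
Qed.

Section OrbitSpace.
Context {R : realType} {G : groupType} {X : metricType R}.
Variables (a : isometric_action G X) (cl : orbits_closed a).

Lemma mdist_orbit_class_le (x y : X) :
  (mdist (orbit_class cl x) (orbit_class cl y) <= mdist x y)%R.
Proof.
rewrite mdist_orbit_space; apply: ge_inf; last by exists (x, y).
by exists 0%R => _ [p _ <-]; exact: mdist_ge0.
Qed.

(** Representatives of the two classes have the form [a g x] and [a h y], so the infimum can be
    tested on group elements, where equivariance applies. *)
Lemma le_mdist_orbit_class (x y : X) (z : \bar R) :
  (forall g h, z <= (mdist (a g x) (a h y))%:E) ->
  z <= (mdist (orbit_class cl x) (orbit_class cl y))%:E.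
Proof.
move=> zxy; rewrite mdist_orbit_space; apply: le_EFin_inf.
  by exists (mdist x y), (x, y).
move=> _ [[p q] /= [px qy] <-].
have /orbit_classP[g _ <-] := esym px.
by have /orbit_classP[h _ <-] := esym qy.
Qed.

Lemma orbit_class_act (g : G) (x : X) :
  orbit_class cl (a g x) = orbit_class cl x.
Proof. by apply/esym/orbit_classP; exists g. Qed.

End OrbitSpace.

Section InducedBounds.
Context {R : realType} {G : groupType} {X Y : metricType R}.
Variables (aX : isometric_action G X) (aY : isometric_action G Y).
Variables (cX : orbits_closed aX) (cY : orbits_closed aY).
Variables (f : X -> Y) (fE : equivariant aX aY f).

Lemma is_lip_lower_induced (b : \bar R) :
  is_lip_lower f b -> is_lip_lower (induced_map cX cY f) b.
Proof.
move=> [b0 bf]; split=> // u v.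
have [x <-] := orbit_class_surj u; have [y <-] := orbit_class_surj v.
rewrite !induced_mapE//; apply: le_mdist_orbit_class => g h.
(* By equivariance the pair in [Y] is the image of [aX g x] and [aX h y], whose distance dominates
   that of their classes. *)
rewrite -!fE; apply: le_trans (bf _ _).
rewrite -(orbit_class_act _ cX g x) -(orbit_class_act _ cX h y).
by apply: lee_wpmul2l => //; rewrite lee_fin mdist_orbit_class_le.
Qed.

Lemma is_lip_upper_induced (b : \bar R) :
  is_lip_upper f b -> is_lip_upper (induced_map cX cY f) b.
Proof.
move=> [b0 bf]; split=> // u v.
have [->|uv] := eqVneq u v; first by rewrite !mdistxx mule0.
have d0 : (0 < mdist u v)%R by rewrite mdist_gt0.
have [x xu] := orbit_class_surj u; have [y yv] := orbit_class_surj v.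
(* The images of [aX g x] and [aX h y] under [f] represent the same two classes in [Y/G] for all [g]
   and [h]. *)
have le_fxy g h : (mdist (induced_map cX cY f u) (induced_map cX cY f v))%:E
    <= b * (mdist (aX g x) (aX h y))%:E.
  apply: le_trans (bf _ _); rewrite lee_fin -xu -yv.
  rewrite -(orbit_class_act _ cX g x) -(orbit_class_act _ cX h y).
  by rewrite !induced_mapE// mdist_orbit_class_le.
(* Passing to the infimum over [g] and [h] is done by dividing by [b], hence for [0 < b < +oo]. If
   [b = +oo], the right side is [+oo] because [u] and [v] are at positive distance; if [b = 0], one
   pair suffices. *)
case: b b0 {bf} le_fxy => [r| |//]; last by rewrite gt0_mulye ?lte_fin ?leey.
rewrite lee_fin le_eqVlt => /orP[/eqP <- /(_ 1%g 1%g)|r0 le_fxy].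
  by rewrite !mul0e.
rewrite -lee_pdivrMl// -xu -yv; apply: le_mdist_orbit_class => g h.
by rewrite lee_pdivrMl// xu yv.
Qed.

(** The optimal bound is attained, so it is itself a bound that [f] passes on to the induced map. *)
Lemma lip_lower_induced : lip_lower f <= lip_lower (induced_map cX cY f).
Proof. by apply lip_lowerP; apply: is_lip_lower_induced; apply lip_lowerP. Qed.

Lemma lip_upper_induced : lip_upper (induced_map cX cY f) <= lip_upper f.
Proof. by apply lip_upperP; apply: is_lip_upper_induced; apply lip_upperP. Qed.

End InducedBounds.

Lemma distortion_le (R : realType) (X Y X' Y' : metricType R)
    (f : X -> Y) (f' : X' -> Y') :
  lip_lower f <= lip_lower f' -> lip_upper f' <= lip_upper f ->
  distortion f' <= distortion f.
Proof.
move=> ll' uu'; rewrite {2}/distortion; case: ifPn => [_|]; first exact: leey.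
rewrite negb_or => /andP[l_neq0 u_neqy].
(* Positivity of the lower bound and finiteness of the upper one carry over from [f] to [f'], so
   both distortions are genuine quotients. *)
have l0 : 0 < lip_lower f by rewrite lt0e l_neq0; case: (lip_lowerP f) => -[].
have l'0 : 0 < lip_lower f' := lt_le_trans l0 ll'.
have u'0 : 0 <= lip_upper f' by case: (lip_upperP f') => -[].
rewrite /distortion gt_eqF//= lt_eqF; last first.
  by rewrite (le_lt_trans uu')// ltey.
(* The inverse of [lip_lower f'] may vanish, since [lip_lower f'] can be [+oo]; nonnegativity is
   enough here. *)
apply: lee_pmul => //; first by rewrite inve_ge0; exact: ltW.
by rewrite lee_pV2 //= inE ltW.
Qed.

Theorem lemma5 (R : realType) (G : groupType) (X Y : metricType R)
  (aX : isometric_action G X) (aY : isometric_action G Y)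
  (cX : orbits_closed aX) (cY : orbits_closed aY)
  (f : X -> Y) (fE : equivariant aX aY f) :
  [/\ lip_lower f <= lip_lower (induced_map cX cY f),
      lip_upper (induced_map cX cY f) <= lip_upper f
    & distortion (induced_map cX cY f) <= distortion f].
Proof.
have ll := lip_lower_induced _ _ cX cY f fE.
have uu := lip_upper_induced _ _ cX cY f fE.
by split=> //; exact: distortion_le.
Qed.
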